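(* Let $n\ge1$ and $T>0$. There exists an instance of the Hamilton–Jacobi–Bellman equation $$\mathcal{L}_{\mathrm{HJB}}u:=\partial_t u+\tfrac12\sigma^2\Delta u-\sum_{i=1}^n A_i|\partial_{x_i}u|^{c_i}=\varphi \ \text{ on } \mathbb{R}^n\times[0,T],\qquad \mathcal{B}_{\mathrm{HJB}}u:=u(\cdot,T)=g \ \text{ on }\mathbb{R}^n$$ (with some $\sigma>0$, $A_i>0$, $c_i\in(1,\infty)$, and functions $\varphi,g$), whose exact solution is $u^*$, such that for any $\varepsilon>0$, $A>0$, $r\ge1$, $m\in\mathbb{N}$ and $p\in[1,\frac n4]$ there exists a function $u\in C^\infty(\mathbb{R}^n\times(0,T])$ satisfying: (1) $\|\mathcal{L}_{\mathrm{HJB}}u-\varphi\|_{L^p(\mathbb{R}^n\times[0,T])}<\varepsilon$, $\mathcal{B}_{\mathrm{HJB}}u=\mathcal{B}_{\mathrm{HJB}}u^*$, and $\mathrm{supp}(u-u^* )$ is compact; (2) $\|u-u^*\|_{W^{m,r}(\mathbb{R}^n\times[0,T])}>A$.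
   Context: For $Q\subseteq\mathbb{R}^n\times[0,T]$, $W^{m,r}(Q)=\{f\in L^r(Q): D^\alpha f\in L^r(Q)\ \forall\alpha\in\mathbb{N}^n,|\alpha|\le m\}$, where $D^\alpha$ acts only on the spatial variable $x$, with norm $\|f\|_{W^{m,r}(Q)}=(\sum_{|\alpha|\le m}\|D^\alpha f\|_{L^r(Q)}^r)^{1/r}$. $\mathrm{supp}f$ is the closure of $\{f\neq0\}$. *)

(* Defs.v *)
From HB Require Import structures.
From mathcomp Require Import all_boot all_order all_algebra.
From mathcomp Require Import all_classical all_reals all_analysis.
Import Order.TTheory GRing.Theory Num.Theory.
Import numFieldNormedType.Exports.
Set Implicit Arguments. Unset Strict Implicit. Unset Printing Implicit Defensive.
Local Open Scope ring_scope.
Local Open Scope classical_set_scope.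

Section HJBDefs.
Variable R : realType.

Definition pt (n : nat) := ('rV[R]_n * R)%type.

Definition dirx n (i : 'I_n) : pt n := (delta_mx 0 i, 0).
Definition dirt n : pt n := (0, 1).

Definition pdx n (i : 'I_n) (f : pt n -> R) (z : pt n) : R := derive f z (dirx i).
Definition pdt n (f : pt n -> R) (z : pt n) : R := derive f z (dirt n).

Definition laplacian n (f : pt n -> R) (z : pt n) : R :=
  \sum_(i < n) pdx i (pdx i f) z.

Definition HJB n (sigma : R) (A c : 'I_n -> R) (f : pt n -> R) (z : pt n) : R :=
  pdt f z + sigma ^+ 2 / 2 * laplacian f z
  - \sum_(i < n) A i * powR `|pdx i f z| (c i).

Definition coord_dir n (v : pt n) : Prop := v = dirt n \/ exists i, v = dirx i.

Definition iderv n (ds : seq (pt n)) (f : pt n -> R) : pt n -> R :=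
  foldr (fun v g => fun z => derive g z v) f ds.

Definition smooth_open n (U : set (pt n)) (f : pt n -> R) : Prop :=
  forall ds : seq (pt n), (forall v, v \in ds -> coord_dir v) ->
    (forall z, U z -> forall v, coord_dir v -> derivable (iderv ds f) z v) /\
    (forall z, U z -> {for z, continuous (iderv ds f)}).

Definition smooth_on n (S : set (pt n)) (f : pt n -> R) : Prop :=
  exists U : set (pt n), [/\ open U, S `<=` U &
    exists v : pt n -> R, smooth_open U v /\ (forall z, S z -> v z = f z)].

Definition slab_oc n (T : R) : set (pt n) := [set z | 0 < z.2 <= T].
Definition slab_cc n (T : R) : set (pt n) := [set z | 0 <= z.2 <= T].

(* Lebesgue integral over R^n of a function with values in \bar R,
   computed as the iterated integral dx_1 ... dx_n (Tonelli) *)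
Fixpoint intRn (n : nat) : ('rV[R]_n -> \bar R) -> \bar R :=
  match n return ('rV[R]_n -> \bar R) -> \bar R with
  | 0 => fun F => F 0
  | k.+1 => fun F =>
      (\int[@lebesgue_measure R]_(a in [set: R])
          intRn (fun y : 'rV[R]_k => F (row_mx (a%:M : 'M[R]_1) y)))%E
  end.

Definition intSlab n (T : R) (F : pt n -> \bar R) : \bar R :=
  (\int[@lebesgue_measure R]_(t in `[0%R, T]%classic) intRn (fun x => F (x, t)))%E.

Definition LpSlab n (p T : R) (f : pt n -> R) : \bar R :=
  poweR (intSlab T (fun z => (powR `|f z| p)%:E)) p^-1.

Definition Dalpha n (a : 'I_n -> nat) (f : pt n -> R) : pt n -> R :=
  foldr (fun i g => iter (a i) (pdx i) g) f (enum 'I_n).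

Definition WmrSlab n (m : nat) (r T : R) (f : pt n -> R) : \bar R :=
  poweR (\sum_(a : {ffun 'I_n -> 'I_m.+1} | (\sum_(i < n) (a i : nat) <= m)%N)
           intSlab T (fun z => (powR `|Dalpha (fun i => (a i : nat)) f z| r)%:E))%E
        r^-1.

End HJBDefs.

(* Main.v *)
(* With sigma = 1, A_i = 1/2, c_i = 2 and u* = 0 the Hopf-Cole substitution
   u = - ln v turns the residual into - (v_t + (1/2) Laplacian v) / v. Let w be a
   huge constant N times the backward heat kernel started at time T + d^2. It
   solves v_t + (1/2) Laplacian v = 0, so - ln (1 + w) is an exact solution, of
   size about ln N on a fixed region however small d is, but it is concentrated
   near x = 0 when t = T. Switching it on during a time of order d^3 costs a
   residual of order d^-3 (up to logarithms) on a ball of radius about d, which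
   is small in L^p because 3 p < n. Finally w is replaced by kappa H(w / kappa - 1)
   with kappa = d^3 and the smooth function H(y) = y exp (- 1 / y) for y > 0,
   H(y) = 0 for y <= 0: this makes the support compact and costs a residual of
   order d. *)
Require Import Defs.
From HB Require Import structures.
From mathcomp Require Import all_boot all_order all_algebra.
From mathcomp Require Import all_classical all_reals all_analysis.
From mathcomp Require Import ring lra zify.
Import Order.TTheory GRing.Theory Num.Theory.
Import numFieldNormedType.Exports.
Set Implicit Arguments.
Unset Strict Implicit.
Local Open Scope ring_scope.
Local Open Scope classical_set_scope.

(** * Functions built from affine ones by sums, products and smooth maps of the line *)

(** Proved on the line t -> f (t v + z), where it becomes the one-variable chain rule; only
    derivability along [v] is assumed of [f]. *)
Lemma is_derive_comp1 (R : realType) (V : normedModType R) (h : R -> R)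
    (f : V -> R) (z v : V) (dh df : R) :
  is_derive z v f df -> is_derive (f z) 1 h dh ->
  is_derive z v (h \o f) (dh * df).
Proof.
move=> [fz <-] hz.
pose line (g : V -> R) (t : R) := g (t *: v + z).
have lineE (g : V -> R) : 'D_v g z = 'D_1 (line g) 0.
  rewrite /derive; set d1 := (fun _ : R => _); set d2 := (fun _ : R => _).
  suff -> : d1 = d2 by [].
  by apply/funext => t; rewrite /d1 /d2 /line /= addr0 scale0r add0r [_%:A]mulr1.
have H : is_derive (0 : R) 1 (line f) ('D_v f z).
  by apply: DeriveDef; [exact: (derivable1P f z v).1|rewrite lineE].
have hz' : is_derive (line f 0) 1 h dh by rewrite /line scale0r add0r.
have [K1 K2] := is_derive1_comp hz' H.
by apply: DeriveDef; [exact: (derivable1P (h \o f) z v).2|rewrite lineE].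
Qed.

Lemma linear_is_diff (R : realType) (V : normedModType R) (f : V -> R) z :
  linear f -> continuous f -> is_diff z f f.
Proof.
move=> fl fc; pose mf := GRing.isLinear.Build _ _ _ _ f fl.
pose F : {linear V -> R} := HB.pack f mf.
by split; [exact: (@linear_differentiable _ _ _ F)|exact: (@diff_lin _ _ _ F)].
Qed.

Lemma linear_is_derive (R : realType) (V : normedModType R) (f : V -> R) z v :
  linear f -> continuous f -> is_derive z v f (f v).
Proof.
move=> fl fc; have [fz dfz] := linear_is_diff z fl fc.
by apply: DeriveDef; [exact: diff_derivable|rewrite deriveE// dfz].
Qed.

(* [D] is the set on which smoothness is required. Asking for a whole class of
   functions closed under derivation avoids closed forms of iterated derivatives. *)
Definition smooth1 (R : realType) (D : set R) (h : R -> R) : Prop :=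
  exists P : (R -> R) -> Prop, P h /\
    forall g, P g -> exists2 g', P g' & forall x, D x -> is_derive x 1 g (g' x).

(** A syntactic class in place of an analytic notion of smoothness: derivatives are handled by
    induction on the formation rules. In [sm_comp] the outer function is smooth on a set [D]
    containing the values taken on [U], which admits [ln] and inverse powers. *)
Inductive sm (R : realType) (V : normedModType R) (U : set V) :
    (V -> R) -> Prop :=
| sm_cst c : sm U (cst c)
| sm_linear (f : V -> R) : linear f -> continuous f -> sm U f
| sm_add f g : sm U f -> sm U g -> sm U (f \+ g)
| sm_mul f g : sm U f -> sm U g -> sm U (f \* g)
| sm_comp D h f : smooth1 D h -> sm U f -> (forall z, U z -> D (f z)) ->
    sm U (h \o f).

Section smooth_class.
Context (R : realType) (V : normedModType R) (U : set V).

Lemma sm_sum (I : Type) (s : seq I) (F : I -> V -> R) :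
  (forall i, sm U (F i)) -> sm U (fun z => \sum_(i <- s) F i z).
Proof.
move=> FU; elim: s => [|i s ih].
  rewrite (_ : (fun _ => _) = cst 0) ?funeqE; first exact: sm_cst.
  by move=> z; rewrite big_nil.
rewrite (_ : (fun _ => _) = F i \+ (fun z => \sum_(j <- s) F j z)).
  exact: sm_add.
by apply/funext => z; rewrite big_cons.
Qed.

Lemma sm_differentiable (f : V -> R) z : sm U f -> U z -> differentiable f z.
Proof.
move=> fU Uz; elim: fU => {f}.
- by move=> c; exact: differentiable_cst.
- by move=> f fl fc; have [] := linear_is_diff z fl fc.
- by move=> f g _ df _ dg; exact: differentiableD.
- by move=> f g _ df _ dg; exact: differentiableM.
- move=> D h f [P [Ph Pd]] _ df UD; apply: differentiable_comp => //.
  have [h' _ hh'] := Pd _ Ph; apply/derivable1_diffP.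
  by have [] := hh' _ (UD _ Uz).
Qed.

(** The product and chain rules lead to functions formed by the same rules. The identity holds on
    [U] only, since outer functions are controlled only on their sets [D]. *)
Lemma sm_derive (f : V -> R) v : sm U f ->
  exists2 g, sm U g & forall z, U z -> 'D_v f z = g z.
Proof.
elim=> {f}.
- by move=> c; exists (cst 0) => [|z _]; [exact: sm_cst|rewrite derive_cst].
- move=> f fl fc; exists (cst (f v)) => [|z _]; first exact: sm_cst.
  by have [] := linear_is_derive z v fl fc.
- move=> f g sf [f' sf' ff'] sg [g' sg' gg'].
  exists (f' \+ g'); first exact: sm_add.
  move=> z Uz; rewrite deriveD; first by rewrite ff'// gg'.
    exact/diff_derivable/sm_differentiable.
  exact/diff_derivable/sm_differentiable.
- move=> f g sf [f' sf' ff'] sg [g' sg' gg'].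
  exists ((f \* g') \+ (g \* f')); first by apply: sm_add; exact: sm_mul.
  move=> z Uz; rewrite deriveM; first by rewrite ff'// gg'.
    exact/diff_derivable/sm_differentiable.
  exact/diff_derivable/sm_differentiable.
- move=> D h f [P [Ph Pd]] sf [f' sf' ff'] UD.
  have [h' Ph' hh'] := Pd _ Ph.
  exists ((h' \o f) \* f').
    by apply: sm_mul => //; apply: (@sm_comp _ _ _ D) => //; exists P.
  move=> z Uz /=; rewrite -ff'//.
  have fz : is_derive z v f ('D_v f z).
    exact/derivableP/diff_derivable/sm_differentiable.
  by have [] := is_derive_comp1 fz (hh' _ (UD _ Uz)).
Qed.

End smooth_class.

(** Each iterated derivative coincides on [U] with a member of the class. As [U] is open, they
    coincide near each of its points, which passes to the next derivative and to continuity. *)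
Lemma sm_smooth_open (R : realType) (n : nat) (U : set (pt R n)) (f : pt R n -> R) :
  open U -> sm U f -> smooth_open U f.
Proof.
move=> oU sf ds _.
have [g sg fg] : exists2 g, sm U g & forall z, U z -> iderv ds f z = g z.
  elim: ds => [|v ds [g sg fg]]; first by exists f.
  have [g' sg' gg'] := sm_derive v sg.
  exists g' => // z Uz; rewrite -gg'//=; apply: near_eq_derive.
  near=> y; apply: fg; near: y; exact: open_nbhs_nbhs.
have nearU z : U z -> \near z, g z = iderv ds f z.
  move=> Uz; near=> y; apply/esym/fg; near: y; exact: open_nbhs_nbhs.
split=> z Uz.
  move=> v _; have gz : derivable g z v.
    exact/diff_derivable/(sm_differentiable sg Uz).
  exact: near_eq_derivable (nearU _ Uz) gz.
suff : iderv ds f y @[y --> z] --> g z by rewrite -fg.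
apply: cvg_trans (near_eq_cvg (nearU _ Uz)) _.
exact: differentiable_continuous (sm_differentiable sg Uz).
Unshelve. all: by end_near. Qed.

(** * Smooth functions of one real variable *)

Lemma smooth1_expR (R : realType) : smooth1 setT (@expR R).
Proof.
exists (eq expR); split=> // _ <-; exists expR => // x _.
exact: is_derive_expR.
Qed.

Lemma is_derive_inv (R : realType) (x : R) : 0 < x ->
  is_derive x 1 (fun y => y^-1) (- x ^- 2).
Proof.
move=> x0; have x0' : x != 0 by rewrite gt_eqF.
apply: DeriveDef; first by apply: (@derivableV _ _ id).
by rewrite (@deriveV _ _ id)// derive_id [_ *: _]mulr1.
Qed.

Lemma is_derive_invX (R : realType) (k : nat) (x : R) : 0 < x ->
  is_derive x 1 (fun y => y ^- k) (- k%:R * x ^- k.+1).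
Proof.
move=> x0; have x0' : x != 0 by rewrite gt_eqF.
have := is_deriveX k (is_derive_inv x0).
rewrite (_ : (fun _ => _) ^+ k = fun y => y ^- k); last first.
  by apply/funext => y; rewrite -exprVn; elim: k => // k ih; rewrite !exprS fctE ih.
move=> H; apply: is_derive_eq H _.
rewrite /GRing.scale; case: k => [|k] /=; first by rewrite oppr0 !mul0r.
rewrite -!exprVn !exprS; ring.
Qed.

(** The multiples c y^-j form a class closed under derivation. *)
Lemma smooth1_invX (R : realType) (k : nat) :
  smooth1 [set x : R | 0 < x] (fun y => y ^- k).
Proof.
exists (fun g => exists c j, g = fun y => c * y ^- j); split.
  by exists 1, k; apply/funext => y; rewrite mul1r.
move=> _ [c [j ->]]; exists (fun y => (- (c * j%:R)) * y ^- j.+1).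
  by exists (- (c * j%:R)), j.+1.
move=> x /= x0; have := is_deriveZ c (is_derive_invX j x0).
by move=> H; apply: is_derive_eq H _; rewrite /GRing.scale /=; ring.
Qed.

Lemma smooth1_ln (R : realType) : smooth1 [set x : R | 0 < x] (@ln R).
Proof.
have [P [Pi Pd]] := smooth1_invX R 1.
exists (fun g => g = @ln R \/ P g); split; first by left.
move=> g [->|Pg].
  by exists (fun y => y ^- 1); [right|move=> x x0; rewrite expr1; exact: is_derive1_ln].
by have [g' Pg' gg'] := Pd _ Pg; exists g' => //; right.
Qed.

(** * The functions z^-k exp (- 1 / z), flat at 0 *)

Definition flat (R : realType) (k : nat) (z : R) : R :=
  if 0 < z then z ^- k * expR (- z^-1) else 0.

Lemma flat_ge0 (R : realType) k (z : R) : 0 <= flat k z.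
Proof.
rewrite /flat; case: ifPn => // z0.
by rewrite mulr_ge0 ?expR_ge0// invr_ge0 exprn_ge0 ?ltW.
Qed.

(** From exp x >= x^m / m! at x = 1 / z with m = k + j. The free exponent [j] is 2 for the
    derivative at 0, 0 for plain bounds, and 4 in [exp_inv_le]. *)
Lemma flat_le (R : realType) k j (z : R) : 0 <= z -> flat k z <= (k + j)`!%:R * z ^+ j.
Proof.
move=> z0; rewrite /flat; case: ifPn => [{z0}z0|_]; last by rewrite mulr_ge0 ?exprn_ge0.
have zi : 0 < z^-1 by rewrite invr_gt0.
have H : z^-1 ^+ (k + j) / (k + j)`!%:R <= expR z^-1.
  case: (k + j)%N => [|m].
    by rewrite expr0 fact0 divr1 -expR0 ler_expR ltW.
  by apply: le_trans (expR_ge1Dxn m (ltW zi)); rewrite lerDr.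
have F : 0 < (k + j)`!%:R :> R by rewrite ltr0n fact_gt0.
rewrite expRN -exprVn.
have -> : z^-1 ^+ k = z^-1 ^+ (k + j) * z ^+ j.
  by rewrite exprD -mulrA -exprMn mulVf ?gt_eqF// expr1n mulr1.
rewrite mulrAC ler_wpM2r ?exprn_ge0 ?(ltW z0)//.
by rewrite ler_pdivrMr ?expR_gt0// -ler_pdivrMl// mulrC.
Qed.

Lemma is_derive_flat (R : realType) k (z : R) :
  is_derive z 1 (@flat R k) (flat k.+2 z - k%:R * flat k.+1 z).
Proof.
have [z0|z0|->] := ltgtP z 0.
- have flat0 (y : R) j : y <= 0 -> flat j y = 0 by rewrite /flat ltNge => ->.
  rewrite !flat0 ?ltW// mulr0 subr0.
  apply: (@near_eq_is_derive _ _ _ (cst 0)); last first.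
  by near=> y; rewrite flat0 ?ltW//; near: y; exact: lt_nbhsl.
- have flatE (y : R) j : 0 < y -> flat j y = y ^- j * expR (- y^-1) by rewrite /flat => ->.
  rewrite !flatE//.
  have near_flat : \near z, (fun y => y ^- k * expR (- y^-1)) z = flat k z.
    by near=> y; rewrite flatE//; near: y; exact: lt_nbhsr.
  have := is_deriveM (is_derive_invX k z0)
    (is_derive_comp1 (is_deriveN (is_derive_inv z0)) (is_derive_expR _)).
  move=> H; apply: (near_eq_is_derive near_flat); apply: is_derive_eq H _.
  rewrite /GRing.scale /= -!exprVn !exprS; ring.
- rewrite /flat ltxx mulr0 subr0.
  (* The difference quotient at 0 is at most (k + 2)! h for h > 0 by [flat_le], and it is 0 for h <
     0. *)
  have H : (h^-1 * @flat R k h @[h --> (0 : R)^'] --> (0 : R)).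
    apply/cvgr0Pnorm_lt => e e0.
    pose c : R := (k + 2)`!%:R.
    have c0 : 0 < c by rewrite ltr0n fact_gt0.
    near=> h.
    have h0 : h != 0 by near: h; exact: nbhs_dnbhs_neq.
    have he : `|h| < e / c.
      by near: h; apply: dnbhs0_lt; rewrite divr_gt0.
    have [hp|hn] := ltP 0 h; last by rewrite /flat [0 < h]ltNge hn/= mulr0 normr0.
    rewrite ger0_norm ?mulr_ge0 ?flat_ge0 ?invr_ge0 ?(ltW hp)//.
    rewrite ltr_pdivrMl//; apply: le_lt_trans (flat_le k 2 (ltW hp)) _.
    rewrite -/c expr2 mulrA mulrC ltr_pM2l// mulrC -ltr_pdivlMr//.
    by rewrite -[h]gtr0_norm.
  have E : (fun h : R => h^-1 *: ((@flat R k \o shift 0) (h *: 1) - flat k 0)) =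
           fun h => h^-1 * flat k h.
    by apply/funext => h; rewrite /= [h%:A]mulr1 addr0 {2}/flat ltxx subr0.
  apply: DeriveDef; first by rewrite /derivable E; apply/cvg_ex; exists 0.
  by rewrite /derive E; exact: cvg_lim H.
Unshelve. all: by end_near. Qed.

(** The derivative of one [flat] combines two others, so the class consists of finite linear
    combinations, coded as lists of pairs of a coefficient and an index. *)
Lemma smooth1_flat (R : realType) k : smooth1 setT (@flat R k).
Proof.
exists (fun g => exists s : seq (R * nat),
  g = fun z => \sum_(c <- s) c.1 * flat c.2 z); split.
  by exists [:: (1, k)]; apply/funext => z; rewrite big_seq1 mul1r.
move=> _ [s ->].
exists (fun z => \sum_(c <- flatten [seq [:: (c.1, c.2.+2); (- c.1 * c.2%:R, c.2.+1)]
                                      | c <- s]) c.1 * flat c.2 z); first by eexists.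
move=> x _; elim: s => [|c s ih].
  rewrite [X in is_derive _ _ X _](_ : _ = cst 0); last first.
    by apply/funext => z; rewrite big_nil.
  by rewrite big_nil; exact: is_derive_cst.
rewrite [X in is_derive _ _ X _](_ : _ = (c.1 \*: @flat R c.2) \+
    (fun z => \sum_(c <- s) c.1 * flat c.2 z)); last first.
  by apply/funext => z; rewrite big_cons.
have := is_deriveD (is_deriveZ c.1 (is_derive_flat c.2 x)) ih.
move=> H; apply: is_derive_eq H _.
by rewrite /= !big_cons /= /GRing.scale /=; ring.
Qed.

(** * Calculus of the ansatz *)

Section derive_eta.
Context (R : realType) (V : normedModType R) (z v : V).
Implicit Types f g : V -> R.

(** This rule and the following ones restate derivation for functions written with an explicit
    argument, so that nesting them yields the derivative of a displayed expression. *)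
Lemma is_deriveD_eta f g df dg : is_derive z v f df -> is_derive z v g dg ->
  is_derive z v (fun y => f y + g y) (df + dg).
Proof. exact: is_deriveD. Qed.

Lemma is_deriveB_eta f g df dg : is_derive z v f df -> is_derive z v g dg ->
  is_derive z v (fun y => f y - g y) (df - dg).
Proof. exact: is_deriveB. Qed.

Lemma is_deriveN_eta f df : is_derive z v f df -> is_derive z v (fun y => - f y) (- df).
Proof. exact: is_deriveN. Qed.

Lemma is_deriveM_eta f g df dg : is_derive z v f df -> is_derive z v g dg ->
  is_derive z v (fun y => f y * g y) (f z * dg + g z * df).
Proof. exact: is_deriveM. Qed.

Lemma is_deriveZ_eta (c : R) f df : is_derive z v f df ->
  is_derive z v (fun y => c * f y) (c * df).
Proof. exact: is_deriveZ. Qed.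

Lemma is_derive_comp_eta (h : R -> R) f (dh df : R) :
  is_derive z v f df -> is_derive (f z) 1 h dh ->
  is_derive z v (fun y => h (f y)) (dh * df).
Proof. exact: is_derive_comp1. Qed.

Lemma is_deriveV_eta f df : is_derive z v f df -> 0 < f z ->
  is_derive z v (fun y => (f y)^-1) (- (f z) ^- 2 * df).
Proof. by move=> fz fz0; apply: (is_derive_comp_eta fz); exact: is_derive_inv. Qed.

Lemma is_derive_ln_eta f df : is_derive z v f df -> 0 < f z ->
  is_derive z v (fun y => ln (f y)) ((f z)^-1 * df).
Proof. by move=> fz fz0; apply: (is_derive_comp_eta fz); exact: is_derive1_ln. Qed.

Lemma is_derive_expR_eta f df : is_derive z v f df ->
  is_derive z v (fun y => expR (f y)) (expR (f z) * df).
Proof. by move=> fz; apply: (is_derive_comp_eta fz); exact: is_derive_expR. Qed.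

Lemma is_derive_cst_eta (c : R) : is_derive z v (fun=> c) 0.
Proof. exact: is_derive_cst. Qed.

End derive_eta.

Section sm_eta.
Context (R : realType) (V : normedModType R) (U : set V).
Implicit Types f g : V -> R.

Lemma sm_cst_eta (c : R) : sm U (fun=> c). Proof. exact: sm_cst. Qed.

Lemma sm_add_eta f g : sm U f -> sm U g -> sm U (fun y => f y + g y).
Proof. exact: sm_add. Qed.

Lemma sm_mul_eta f g : sm U f -> sm U g -> sm U (fun y => f y * g y).
Proof. exact: sm_mul. Qed.

Lemma sm_opp_eta f : sm U f -> sm U (fun y => - f y).
Proof.
move=> sf; rewrite (_ : (fun _ => _) = fun y => (-1) * f y).
  by apply: sm_mul_eta => //; exact: sm_cst_eta.
by apply/funext => y; rewrite mulN1r.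
Qed.

Lemma sm_expR f : sm U f -> sm U (fun y => expR (f y)).
Proof. by move=> sf; apply: (sm_comp (@smooth1_expR R) sf). Qed.

Lemma sm_ln f : sm U f -> (forall z, U z -> 0 < f z) -> sm U (fun y => ln (f y)).
Proof. by move=> sf f0; apply: (sm_comp (@smooth1_ln R) sf). Qed.

Lemma sm_inv f : sm U f -> (forall z, U z -> 0 < f z) -> sm U (fun y => (f y)^-1).
Proof. by move=> sf f0; apply: (sm_comp (@smooth1_invX R 1) sf). Qed.

Lemma sm_flat k f : sm U f -> sm U (fun y => flat k (f y)).
Proof. by move=> sf; apply: (sm_comp (@smooth1_flat R k) sf). Qed.

End sm_eta.

Section coordinates.
Context (R : realType) (n : nat).
Implicit Types (z v : pt R n) (i j : 'I_n).

Lemma coord_linear j : linear (fun z : pt R n => z.1 0 j : R).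
Proof. by move=> a z w /=; rewrite !mxE. Qed.

Lemma coord_continuous_pt j : continuous (fun z : pt R n => z.1 0 j : R).
Proof.
move=> z; apply: (@continuous_comp _ _ _ fst (fun x : 'rV[R]_n => x 0 j)).
  exact: cvg_fst.
exact: coord_continuous.
Qed.

Lemma time_linear : linear (fun z : pt R n => z.2 : R).
Proof. by []. Qed.

Lemma time_continuous : continuous (fun z : pt R n => z.2 : R).
Proof. by move=> z; exact: cvg_snd. Qed.

Lemma is_derive_coord z v j : is_derive z v (fun y : pt R n => y.1 0 j : R) (v.1 0 j).
Proof.
exact: (linear_is_derive z v (coord_linear j) (@coord_continuous_pt j)).
Qed.

Lemma is_derive_time z v : is_derive z v (fun y : pt R n => y.2 : R) v.2.
Proof. exact: (linear_is_derive z v time_linear time_continuous). Qed.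

Lemma is_derive_sqnorm z v :
  is_derive z v (fun y : pt R n => \sum_j (y.1 0 j) ^+ 2) (\sum_j 2 * z.1 0 j * v.1 0 j).
Proof.
rewrite (_ : (fun _ => _) = \sum_j (fun y : pt R n => (y.1 0 j : R) ^+ 2)); last first.
  by apply/funext => y; rewrite fct_sumE.
apply: is_derive_sum => j.
rewrite (_ : (fun _ => _) = fun y : pt R n => y.1 0 j * y.1 0 j); last first.
  by apply/funext => y; rewrite expr2.
apply: is_derive_eq (is_deriveM_eta (is_derive_coord z v j) (is_derive_coord z v j)) _.
by ring.
Qed.

End coordinates.

(** * The cutoff profile and its logarithmic slope *)

Section flat_id.
Context (R : realType).
Implicit Types y : R.

(** The function H of the opening comment. It is asymptotic to y for large y, and its second
    derivative is [flat 3]. *)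
Definition fid y : R := y * flat 0 y.
Definition fid' y : R := flat 0 y + flat 1 y.

Lemma flat_shift k y : y * flat k.+1 y = flat k y.
Proof.
rewrite /flat; case: ifPn => [y0|_]; last by rewrite mulr0.
by rewrite mulrA -!exprVn exprS mulrA divff ?gt_eqF// mul1r.
Qed.

Lemma is_derive_fid y : is_derive y 1 fid (fid' y).
Proof.
have := is_deriveM_eta (is_derive_id y 1) (is_derive_flat 0 y).
move=> H; apply: is_derive_eq H _.
by rewrite mul0r subr0 flat_shift mulr1 addrC.
Qed.

Lemma is_derive_fid' y : is_derive y 1 fid' (flat 3 y).
Proof.
have := is_deriveD_eta (is_derive_flat 0 y) (is_derive_flat 1 y).
by move=> H; apply: is_derive_eq H _; ring.
Qed.

Lemma fid_ge0 y : 0 <= fid y.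
Proof.
rewrite /fid /flat; case: ifPn => [y0|_]; last by rewrite mulr0.
by rewrite !mulr_ge0 ?expR_ge0 ?invr_ge0 ?ltW.
Qed.

Lemma fid'_ge0 y : 0 <= fid' y.
Proof. by rewrite addr_ge0 ?flat_ge0. Qed.

End flat_id.

Section log_slope.
Context (R : realType) (kap : R) (kap0 : 0 <= kap).
Implicit Types y : R.

(** The derivative of ln (1 + kap fid y) with respect to ln (y + 1). At y = [ww z] the variable ln
    (y + 1) is [logw z], whose derivatives are explicit. *)
Definition slope y : R := kap * fid' y * (y + 1) / (1 + kap * fid y).
Definition slope' y : R :=
  kap * (flat 3 y * (y + 1) + fid' y) / (1 + kap * fid y)
  - (kap * fid' y) ^+ 2 * (y + 1) / (1 + kap * fid y) ^+ 2.

Lemma den_gt0 y : 0 < 1 + kap * fid y.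
Proof. by rewrite ltr_pwDl// mulr_ge0// fid_ge0. Qed.

Lemma is_derive_den y : is_derive y 1 (fun x => 1 + kap * fid x) (kap * fid' y).
Proof.
have := is_deriveD_eta (is_derive_cst_eta y 1 1) (is_deriveZ_eta kap (is_derive_fid y)).
by move=> H; apply: is_derive_eq H _; ring.
Qed.

Lemma is_derive_slope y : is_derive y 1 slope (slope' y).
Proof.
have d0 := den_gt0 y.
have := is_deriveM_eta
  (is_deriveM_eta (is_deriveZ_eta kap (is_derive_fid' y))
    (is_deriveD_eta (is_derive_id y 1) (is_derive_cst_eta y 1 1)))
  (is_deriveV_eta (is_derive_den y) d0).
move=> H; apply: is_derive_eq H _; rewrite /slope'; field; rewrite gt_eqF//.
Qed.

(** The Hopf-Cole cancellation. With s = ln (y + 1) and F = ln (1 + kap fid), the sum F_ss - F_s +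
    F_s^2 is (y + 1)^2 times the second derivative of 1 + kap fid, divided by 1 + kap fid. *)
Lemma slope_identity y :
  slope y - (y + 1) * slope' y =
  slope y ^+ 2 - kap * (y + 1) ^+ 2 * flat 3 y / (1 + kap * fid y).
Proof. by rewrite /slope /slope'; field; rewrite gt_eqF// den_gt0. Qed.

Lemma slope_bounds y : kap <= 1 -> 0 <= slope y <= 3.
Proof.
move=> kap1; have d0 := den_gt0 y.
have [y0|y0] := leP y 0.
  by rewrite /slope /fid' /flat ltNge y0/= addr0 mulr0 !mul0r ler0n lexx.
rewrite /slope divr_ge0 ?mulr_ge0 ?fid'_ge0 ?(ltW d0)//=; last by rewrite addr_ge0// ltW.
rewrite ler_pdivrMr// /fid'.
(* The denominator absorbs the term with [fid y]; the other two add up to at most 2 + 1. *)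
have -> : kap * (flat 0 y + flat 1 y) * (y + 1) =
    kap * (fid y + 2 * flat 0 y + flat 1 y).
  by rewrite /fid -(flat_shift 0 y); ring.
have f0 : flat 0 y <= 1 by have := flat_le 0 0 (ltW y0); rewrite expr0 mulr1.
have f1 : flat 1 y <= 1 by have := flat_le 1 0 (ltW y0); rewrite expr0 mulr1.
have : kap * (2 * flat 0 y + flat 1 y) <= 3.
  apply: (@le_trans _ _ (1 * 3)); last by rewrite mul1r.
  by apply: ler_pM => //; [rewrite addr_ge0 ?mulr_ge0 ?flat_ge0|lra].
have : 0 <= kap * fid y by rewrite mulr_ge0 ?fid_ge0.
lra.
Qed.

Lemma flat3_bounds y : 0 <= (y + 1) ^+ 2 * flat 3 y <= 11.
Proof.
rewrite mulr_ge0 ?flat_ge0 ?sqr_ge0//=.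
have [y0|y0] := leP y 0; first by rewrite /flat ltNge y0/= mulr0.
(* The three terms are at most 1!, 2 * 2! and 3!, which sum to 11. *)
have -> : (y + 1) ^+ 2 * flat 3 y = flat 1 y + 2 * flat 2 y + flat 3 y.
  by rewrite -(flat_shift 1 y) -(flat_shift 2 y); ring.
have H k : flat k y <= k`!%:R.
  by have := flat_le k 0 (ltW y0); rewrite expr0 mulr1 addn0.
have := H 1%N; have := H 2%N; have := H 3%N; rewrite !factS fact0 !muln1.
by rewrite !natrM; lra.
Qed.

End log_slope.

(** * The ansatz, its derivatives and its residual *)

Section ansatz.
Context (R : realType) (n : nat) (T e kap tau L : R).
Hypothesis kap0 : 0 <= kap.
Implicit Types z : pt R n.

Definition qt z : R := T + e - z.2.
Definition sqn z : R := \sum_j (z.1 0 j) ^+ 2.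
(* [ww + 1] is a constant times the backward heat kernel started at time [T + e];
   it solves v_t + (1/2) Laplacian v = 0. *)
Definition logw z : R := L - n%:R / 2 * ln (qt z) - sqn z / (2 * qt z).
(** Stands for w / kappa - 1 of the opening comment, so that [fid (ww z)] vanishes where w <=
    kappa. *)
Definition ww z : R := expR (logw z) - 1.
(** Equals 1 at t = T, so the factor 1 - [decay] forces the terminal value 0; it is negligible once
    T - t is large against [tau]. *)
Definition decay z : R := expR (- ((T - z.2) / tau)).
Definition ansatz z : R := - ((1 - decay z) * ln (1 + kap * fid (ww z))).
(** For e > 0 this open set reaches beyond t = T, so that derivatives at t = T are two-sided and
    smoothness holds up to that time. *)
Definition udom : set (pt R n) := [set z | 0 < qt z].

Lemma open_udom : open udom.
Proof.
have -> : udom = (fun z : pt R n => z.2) @^-1` [set t | t < T + e].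
  by apply/seteqP; split=> z /=; rewrite /udom /qt /= subr_gt0.
apply: open_comp; last exact: open_lt.
by move=> z _; exact: time_continuous.
Qed.

Lemma sm_qt : sm udom qt.
Proof.
apply: sm_add_eta; first exact: sm_cst_eta.
by apply: sm_opp_eta; apply: sm_linear; [exact: time_linear|exact: time_continuous].
Qed.

Lemma sm_coord j : sm udom (fun z => z.1 0 j : R).
Proof. by apply: sm_linear; [exact: coord_linear|exact: coord_continuous_pt]. Qed.

Lemma sm_ansatz : sm udom ansatz.
Proof.
have sw : sm udom ww.
  apply: sm_add_eta; last exact: sm_cst_eta.
  apply: sm_expR; apply: sm_add_eta; first apply: sm_add_eta; first exact: sm_cst_eta.
    apply: sm_opp_eta; apply: sm_mul_eta; first exact: sm_cst_eta.
    by apply: sm_ln; [exact: sm_qt|].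
  apply: sm_opp_eta; apply: sm_mul_eta.
    apply: sm_sum => j; rewrite (_ : (fun _ => _) = fun z => z.1 0 j * z.1 0 j).
      by apply: sm_mul_eta; exact: sm_coord.
    by apply/funext => z; rewrite expr2.
  apply: sm_inv; first by apply: sm_mul_eta; [exact: sm_cst_eta|exact: sm_qt].
  by move=> z zU; rewrite mulr_gt0.
apply: sm_opp_eta; apply: sm_mul_eta.
  apply: sm_add_eta; first exact: sm_cst_eta.
  apply: sm_opp_eta; apply: sm_expR; apply: sm_opp_eta.
  apply: sm_mul_eta; last exact: sm_cst_eta.
  apply: sm_add_eta; first exact: sm_cst_eta.
  by apply: sm_opp_eta; apply: sm_linear; [exact: time_linear|exact: time_continuous].
apply: sm_ln => [|z _]; last exact: den_gt0.
apply: sm_add_eta; first exact: sm_cst_eta.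
apply: sm_mul_eta; first exact: sm_cst_eta.
by apply: sm_mul_eta => //; exact: sm_flat.
Qed.

Lemma is_derive_qt z v : is_derive z v qt (- v.2).
Proof.
have := is_deriveB_eta (is_derive_cst_eta z v (T + e)) (is_derive_time z v).
by move=> H; apply: is_derive_eq H _; rewrite sub0r.
Qed.

Lemma is_derive_ww z v : udom z ->
  is_derive z v ww ((ww z + 1) *
    (n%:R / 2 * v.2 / qt z - (\sum_j z.1 0 j * v.1 0 j) / qt z
     - sqn z * v.2 / (2 * qt z ^+ 2))).
Proof.
move=> zU; have q2 : 0 < 2 * qt z by rewrite mulr_gt0.
have := is_deriveB_eta (is_derive_expR_eta (is_deriveB_eta
  (is_deriveB_eta (is_derive_cst_eta z v L)
     (is_deriveZ_eta (n%:R / 2) (is_derive_ln_eta (is_derive_qt z v) zU)))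
  (is_deriveM_eta (is_derive_sqnorm z v)
     (is_deriveV_eta (is_deriveZ_eta 2 (is_derive_qt z v)) q2)))) (is_derive_cst_eta z v 1).
move=> H; apply: is_derive_eq H _; rewrite /ww subrK -/(logw z) subr0; congr (_ * _).
have -> : \sum_j 2 * z.1 0 j * v.1 0 j = 2 * \sum_j z.1 0 j * v.1 0 j.
  by rewrite mulr_sumr; apply: eq_bigr => j _; rewrite mulrA.
by rewrite -/(sqn z); field; rewrite gt_eqF.
Qed.

Lemma is_derive_decay z v : is_derive z v decay (decay z * (v.2 / tau)).
Proof.
have := is_derive_expR_eta (is_deriveN_eta (is_deriveM_eta
  (is_deriveB_eta (is_derive_cst_eta z v T) (is_derive_time z v))
  (is_derive_cst_eta z v tau^-1))).
by move=> H; apply: is_derive_eq H _; rewrite -/(decay z); ring.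
Qed.

Lemma is_derive_ansatz z v dw : is_derive z v ww dw ->
  is_derive z v ansatz (decay z * (v.2 / tau) * ln (1 + kap * fid (ww z))
    - (1 - decay z) * (kap * fid' (ww z) * dw / (1 + kap * fid (ww z)))).
Proof.
move=> Hw; have d0 := den_gt0 kap0 (ww z).
have Hd := is_derive_comp_eta Hw (is_derive_den kap (ww z)).
have := is_deriveN_eta (is_deriveM_eta
  (is_deriveB_eta (is_derive_cst_eta z v 1) (is_derive_decay z v))
  (is_derive_ln_eta Hd d0)).
by move=> H; apply: is_derive_eq H _; ring.
Qed.

Lemma sum_coord_dirx z i : \sum_j z.1 0 j * (@dirx R n i).1 0 j = z.1 0 i.
Proof.
rewrite (bigD1 i)//= mxE !eqxx mulr1 big1 ?addr0// => j ji.
by rewrite mxE eqxx (negPf ji) mulr0.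
Qed.

Lemma sum_coord_dirt z : \sum_j z.1 0 j * (@dirt R n).1 0 j = 0.
Proof. by rewrite big1// => j _; rewrite mxE mulr0. Qed.

Lemma is_derive_ww_dirx z i : udom z ->
  is_derive z (dirx R i) ww (- (ww z + 1) * z.1 0 i / qt z).
Proof.
move=> zU; apply: is_derive_eq (is_derive_ww (dirx R i) zU) _.
by rewrite sum_coord_dirx /=; ring.
Qed.

Definition grad (i : 'I_n) z : R := (1 - decay z) * slope kap (ww z) * (z.1 0 i / qt z).

Lemma pdx_ansatz z i : udom z -> pdx i ansatz z = grad i z.
Proof.
move=> zU; have [_] := is_derive_ansatz (is_derive_ww_dirx i zU).
rewrite /pdx => ->; rewrite /grad /slope /=; ring.
Qed.

Lemma pdxx_ansatz z i : udom z -> pdx i (pdx i ansatz) z =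
  (1 - decay z) * (slope kap (ww z) / qt z
    - slope' kap (ww z) * (ww z + 1) * (z.1 0 i) ^+ 2 / qt z ^+ 2).
Proof.
move=> zU; have q0 : qt z != 0 by rewrite gt_eqF.
(* The closed form of [pdx i ansatz] holds on [udom]; as this set is open, the closed form can be
   differentiated instead. *)
rewrite {1}/pdx (_ : 'D_(dirx R i) (pdx i ansatz) z = 'D_(dirx R i) (grad i) z); last first.
  apply: near_eq_derive; near=> y; apply: pdx_ansatz; near: y.
  exact: (open_nbhs_nbhs (conj open_udom zU)).
have [_ ->] := is_deriveM_eta (is_deriveM_eta
  (is_deriveB_eta (is_derive_cst_eta z (dirx R i) 1) (is_derive_decay z (dirx R i)))
  (is_derive_comp_eta (is_derive_ww_dirx i zU) (is_derive_slope kap0 (ww z))))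
  (is_deriveM_eta (is_derive_coord z (dirx R i) i)
     (is_deriveV_eta (is_derive_qt z (dirx R i)) zU)).
by rewrite /= mxE !eqxx /= mul0r; field.
Unshelve. all: by end_near. Qed.

Lemma pdt_ansatz z : udom z -> pdt ansatz z =
  decay z / tau * ln (1 + kap * fid (ww z))
  - (1 - decay z) * slope kap (ww z) * (n%:R / (2 * qt z) - sqn z / (2 * qt z ^+ 2)).
Proof.
move=> zU; have q0 : qt z != 0 by rewrite gt_eqF.
have [_] := is_derive_ansatz (is_derive_ww (dirt R n) zU).
rewrite /pdt => ->; rewrite sum_coord_dirt /slope /= mul1r.
have d0 : 1 + kap * fid (ww z) != 0 by rewrite gt_eqF ?den_gt0.
by move: (tau^-1) => ti; field; rewrite q0.
Qed.

(** Write s = 1 - decay and G = slope. The terms in n / (2 q) of the time derivative and of the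
    Laplacian cancel. By [slope_identity] the linear part gives s G^2 minus the cutoff term and the
    Hamiltonian gives - s^2 G^2, each times |x|^2 / (2 q^2); what remains of G^2 has the factor s (1
    - s) = s decay. *)
Lemma HJB_ansatz z : udom z ->
  HJB 1 (fun=> 2^-1) (fun=> 2) ansatz z =
  decay z / tau * ln (1 + kap * fid (ww z))
  + (1 - decay z) / 2 * (sqn z / qt z ^+ 2) *
    (decay z * slope kap (ww z) ^+ 2
     - kap * ((ww z + 1) ^+ 2 * flat 3 (ww z)) / (1 + kap * fid (ww z))).
Proof.
move=> zU; have q0 : qt z != 0 by rewrite gt_eqF.
rewrite /HJB pdt_ansatz// /laplacian.
rewrite (eq_bigr _ (fun i _ => pdxx_ansatz i zU)).
rewrite [X in _ - X](_ : _ = 2^-1 * ((1 - decay z) ^+ 2 * slope kap (ww z) ^+ 2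
                               * (sqn z / qt z ^+ 2))); last first.
  rewrite -mulr_sumr; congr (_ * _); rewrite /sqn mulr_suml mulr_sumr.
  apply: eq_bigr => i _; rewrite pdx_ansatz// powR_mulrn// real_normK ?num_real//.
  by rewrite /grad; field.
rewrite -mulr_sumr sumrB sumr_const card_ord.
rewrite -mulr_suml -mulr_sumr -/(sqn z).
have := slope_identity kap0 (ww z).
set G := slope kap (ww z); set G' := slope' kap (ww z); set W := ww z + 1.
set D := 1 + _; set K := flat 3 _.
rewrite -mulr_natl => E.
have {}E : kap * (W ^+ 2 * K) / D = G ^+ 2 - G + W * G'.
  by rewrite mulrA; move: E; move: (_ / D) (W * G') => a b; lra.
rewrite E; move: (decay z / tau * _) => b; field; exact: q0.
Qed.

End ansatz.

(** * Iterated integrals *)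

(* Unlike [ge0_le_integral], this needs no measurability, because the integral
   of a nonnegative function is a supremum over the simple functions below it. *)
Lemma ge0_le_integral_nomeas d (T : measurableType d) (R : realType)
    (mu : {measure set T -> \bar R}) (D : set T) (f g : T -> \bar R) :
  (forall x, D x -> 0 <= f x)%E -> (forall x, D x -> f x <= g x)%E ->
  (\int[mu]_(x in D) f x <= \int[mu]_(x in D) g x)%E.
Proof.
move=> f0 fg; have g0 x : D x -> (0 <= g x)%E.
  by move=> Dx; apply: le_trans (fg _ Dx); exact: f0.
rewrite !ge0_integralE//; apply: ereal_sup_le => _ [h /= hf <-].
exists h => // x; apply: le_trans (hf x) _.
by rewrite /patch; case: ifPn => // /set_mem; exact: fg.
Qed.

Lemma integral_patch_itv (R : realType) (c a b : R) : a <= b ->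
  (\int[@lebesgue_measure R]_(x in [set: R]) (cst c%:E \_ `[a, b]) x =
   (c * (b - a))%:E)%E.
Proof.
move=> ab; rewrite -integral_mkcond integral_cst//= lebesgue_measure_itv/= lte_fin.
case: ltP => [//|ba]; have -> : b = a by apply/le_anti; rewrite ba ab.
by rewrite subrr mulr0 mule0.
Qed.

Lemma integral_le_itv (R : realType) (f : R -> \bar R) (c a b : R) : a <= b ->
  (forall x, 0 <= f x)%E -> (forall x, f x <= c%:E)%E ->
  (forall x, ~~ (a <= x <= b) -> f x = 0%E) ->
  (\int[@lebesgue_measure R]_(x in [set: R]) f x <= (c * (b - a))%:E)%E.
Proof.
move=> ab f0 fc fN; rewrite -integral_patch_itv//.
apply: ge0_le_integral_nomeas => // x _; rewrite /patch mem_setE in_itv/=.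
by case: ifPn => [_|/fN->].
Qed.

Lemma integral_ge_itv (R : realType) (f : R -> \bar R) (c a b : R) : a <= b ->
  0 <= c -> (forall x, 0 <= f x)%E -> (forall x, (a <= x <= b)%R -> c%:E <= f x)%E ->
  ((c * (b - a))%:E <= \int[@lebesgue_measure R]_(x in [set: R]) f x)%E.
Proof.
move=> ab c0 f0 fc; rewrite -integral_patch_itv//.
apply: ge0_le_integral_nomeas => x _; rewrite /patch mem_setE in_itv/=.
  by case: ifPn => // _; rewrite /cst lee_fin.
by case: ifPn => // /fc.
Qed.

Section intRn_bounds.
Context (R : realType).
Implicit Types (n : nat) (c l : R).

Lemma intRn_ge0 n (F : 'rV[R]_n -> \bar R) :
  (forall x, 0 <= F x)%E -> (0 <= intRn F)%E.
Proof.
elim: n F => [|n ih] F F0 //=.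
by apply: integral_ge0 => a _; apply: ih.
Qed.

Lemma intRn_eq0 n (F : 'rV[R]_n -> \bar R) : (forall x, F x = 0%E) -> intRn F = 0%E.
Proof. by elim: n F => [|n ih] F F0 //=; apply: integral0_eq => a _; apply: ih. Qed.

(** [intRn] splits off the first coordinate by [row_mx]; this splits membership in a cube
    accordingly. *)
Lemma row_mx1P n (P : set R) (a : R) (y : 'rV[R]_n) :
  (forall i, P ((row_mx (a%:M : 'M[R]_1) y : 'rV[R]_n.+1) 0 i)) <->
  P a /\ forall i, P (y 0 i).
Proof.
have E0 : (row_mx (a%:M : 'M[R]_1) y : 'rV[R]_n.+1) 0 (lshift n (0 : 'I_1)) = a.
  by rewrite [LHS](row_mxEl (a%:M : 'M[R]_1) y) mxE.
have ES j : (row_mx (a%:M : 'M[R]_1) y : 'rV[R]_n.+1) 0 (rshift 1 j) = y 0 j.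
  by rewrite [LHS](row_mxEr (a%:M : 'M[R]_1) y).
split=> [H|[Pa Py] i]; first by split=> [|j]; [rewrite -E0|rewrite -ES]; apply: H.
by case: (split_ordP (i : 'I_(1 + n))) => j ->; [rewrite ord1 E0|rewrite ES].
Qed.

Lemma intRn_ge_unit_cube n (F : 'rV[R]_n -> \bar R) c : 0 <= c ->
  (forall x, 0 <= F x)%E ->
  (forall x : 'rV[R]_n, (forall i, (0 <= x 0%R i <= 1)%R) -> c%:E <= F x)%E ->
  (c%:E <= intRn F)%E.
Proof.
move=> c0; elim: n F => [|n ih] F F0 Fc /=; first by apply: Fc => -[].
rewrite -[c]mulr1 -[X in c * X]subr0; apply: integral_ge_itv => // [a|a a01].
  by apply: intRn_ge0 => y.
apply: ih => // y y01; apply: Fc.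
exact/(row_mx1P [set t | is_true (0 <= t <= 1)]).
Qed.

(** By induction on the dimension: the inner integral vanishes when the first coordinate leaves
    [- l, l], and each coordinate contributes a factor 2 l. *)
Lemma intRn_le_cube n (F : 'rV[R]_n -> \bar R) c l : 0 <= c -> 0 <= l ->
  (forall x, 0 <= F x)%E -> (forall x, F x <= c%:E)%E ->
  (forall x : 'rV[R]_n, ~ (forall i, - l <= x 0 i <= l) -> F x = 0%E) ->
  (intRn F <= (c * (l *+ 2) ^+ n)%:E)%E.
Proof.
move=> c0 l0; elim: n F => [|n ih] F F0 Fc FN; first by rewrite /= expr0 mulr1.
rewrite exprSr mulrA [X in _ * X](_ : _ = l - - l); last by rewrite opprK.
apply: integral_le_itv => [||a|a aN].
- by rewrite (le_trans _ l0)// oppr_le0.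
- by move=> a; apply: intRn_ge0.
- apply: ih => // y yN; apply: FN => /(row_mx1P [set t | is_true (- l <= t <= l)])[_].
  exact: yN.
- apply: intRn_eq0 => y; apply: FN.
  by move=> /(row_mx1P [set t | is_true (- l <= t <= l)])[la _]; rewrite la in aN.
Qed.

End intRn_bounds.

(** * Norms on the slab from bounds on time slices *)

Lemma LpSlab_lt (R : realType) n (p T eta eps : R) (f : pt R n -> R) :
  0 < T -> 1 <= p -> 0 <= eta -> 0 < eps -> T * eta < powR eps p ->
  (forall t, 0 <= t <= T ->
     (intRn (fun x => (powR `|f (x, t)| p)%:E) <= eta%:E)%E) ->
  (LpSlab p T f < eps%:E)%E.
Proof.
move=> T0 p1 eta0 eps0 Teta feta; rewrite /LpSlab.
have p0 : 0 < p by exact: lt_le_trans p1.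
have I0 t : (0 <= intRn (fun x => (powR `|f (x, t)| p)%:E))%E.
  by apply: intRn_ge0 => x; rewrite lee_fin powR_ge0.
have I : (intSlab T (fun z => (powR `|f z| p)%:E) <= (T * eta)%:E)%E.
  rewrite /intSlab integral_mkcond mulrC -[X in _ * X]subr0.
  apply: integral_le_itv => [|t|t|t tN]; first exact: ltW.
  - by rewrite /patch; case: ifPn.
  - by rewrite /patch mem_setE in_itv/=; case: ifPn => [/feta|_]//; rewrite lee_fin.
  - by rewrite /patch mem_setE in_itv/= (negPf tN).
have -> : eps = powR (powR eps p) p^-1.
  by rewrite -powRrM divff ?gt_eqF// powRr1// ltW.
apply: (@le_lt_trans _ _ (poweR (T * eta)%:E p^-1)); last first.
  rewrite poweR_EFin lte_fin gt0_ltr_powR ?invr_gt0// nnegrE ?powR_ge0//.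
  by rewrite mulr_ge0// ltW.
apply: gt0_ler_poweR => //; first by rewrite invr_ge0 ltW.
- rewrite in_itv/= leey andbT; apply: integral_ge0 => t _; exact: I0.
- by rewrite in_itv/= leey andbT lee_fin mulr_ge0// ltW.
Qed.

Lemma Dalpha0 (R : realType) n (f : pt R n -> R) : Dalpha (fun _ => 0%N) f = f.
Proof. by rewrite /Dalpha; elim: (enum 'I_n) => //= i s ->. Qed.

(** The unit cube times [0, T / 2], a set of volume T / 2, already contributes (T / 2) M^r. *)
Lemma WmrSlab_gt (R : realType) n m (r T M A : R) (f : pt R n -> R) :
  0 < T -> 1 <= r -> 0 <= M -> 0 < A -> powR A r < T / 2 * powR M r ->
  (forall (x : 'rV[R]_n) t, (forall i, 0 <= x 0 i <= 1) ->
     0 <= t <= T / 2 -> M <= `|f (x, t)|) ->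
  (A%:E < WmrSlab m r T f)%E.
Proof.
move=> T0 r1 M0 A0 AM fM; rewrite /WmrSlab.
have r0 : 0 < r by exact: lt_le_trans r1.
have I0 (g : pt R n -> R) t : (0 <= intRn (fun x => (powR `|g (x, t)| r)%:E))%E.
  by apply: intRn_ge0 => x; rewrite lee_fin powR_ge0.
have S0 (g : pt R n -> R) : (0 <= intSlab T (fun z => (powR `|g z| r)%:E))%E.
  by apply: integral_ge0 => t _.
have I : ((T / 2 * powR M r)%:E <= intSlab T (fun z => (powR `|f z| r)%:E))%E.
  rewrite /intSlab integral_mkcond mulrC -[X in _ * X]subr0.
  apply: integral_ge_itv => [|||t /andP[t0 tT]].
  - by rewrite divr_ge0// ltW.
  - by rewrite powR_ge0.
  - by move=> t; rewrite /patch; case: ifPn.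
  - have tT' : t <= T by lra.
    rewrite /patch mem_setE in_itv/= t0 tT' /=.
    apply: intRn_ge_unit_cube => [|x|x x01]; first exact: powR_ge0.
      by rewrite lee_fin powR_ge0.
    rewrite lee_fin ge0_ler_powR ?nnegrE ?(ltW r0)//.
    by rewrite fM// t0.
have -> : A = powR (powR A r) r^-1.
  by rewrite -powRrM divff ?gt_eqF// powRr1// ltW.
apply: (@lt_le_trans _ _ (poweR (T / 2 * powR M r)%:E r^-1)).
  rewrite poweR_EFin lte_fin gt0_ltr_powR ?invr_gt0// nnegrE ?powR_ge0//.
  by rewrite mulr_ge0 ?powR_ge0// divr_ge0// ltW.
apply: gt0_ler_poweR; first by rewrite invr_ge0 ltW.
- by rewrite in_itv/= leey andbT lee_fin mulr_ge0 ?powR_ge0// divr_ge0// ltW.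
- by rewrite in_itv/= leey andbT; apply: sume_ge0 => a _; exact: S0.
apply: le_trans I _.
(* The zero multi-index gives the integral of |f|^r itself; the other terms are nonnegative. *)
rewrite (bigD1 ([ffun=> ord0] : {ffun 'I_n -> 'I_m.+1})) /=; last first.
  by rewrite big1// => i _; rewrite ffunE.
rewrite (_ : (fun i => _) = (fun=> 0%N)); last by apply/funext => i; rewrite ffunE.
by rewrite Dalpha0 leeDl//; apply: sume_ge0 => a _; exact: S0.
Qed.

(** * Estimates *)

Section estimates.
Context (R : realType) (n : nat) (T d lam : R).
Hypotheses (T0 : 0 < T) (d0 : 0 < d) (d1 : d <= 1) (lam1 : 1 <= lam).
Implicit Types z : pt R n.

(* [d ^+ 2], [d ^+ 3], [d ^+ 3] are the parameters [e], [kap], [tau] of [ansatz],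
   and [exp L = exp lam / kap]. *)
Let L := lam - 3 * ln d.
Let q z := qt T (d ^+ 2) z.
Let w z := ww T (d ^+ 2) L z.
Let dec z := decay T (d ^+ 3) z.
(** An upper bound of [logw] for t <= T: it adds to [L] the term - n ln d, which bounds - (n / 2) ln
    q because q >= d^2. *)
Let Lam := lam - (n.+3)%:R * ln d.
Let u : pt R n -> R := ansatz T (d ^+ 2) (d ^+ 3) (d ^+ 3) L.
Let res z := HJB 1 (fun=> 2^-1) (fun=> 2) u z.

Let lnd : ln d <= 0. Proof. exact: ln_le0. Qed.
Let kap0 : 0 <= d ^+ 3. Proof. by rewrite exprn_ge0 ?ltW. Qed.
Let kap1 : d ^+ 3 <= 1. Proof. by rewrite exprn_ile1// ltW. Qed.

Lemma Lam_ge1 : 1 <= Lam.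
Proof.
have : n.+3%:R * ln d <= 0 by rewrite mulr_ge0_le0.
rewrite /Lam; move: (_ * ln d) lam1 => a; lra.
Qed.

Lemma qt_ge z : z.2 <= T -> d ^+ 2 <= q z.
Proof. by rewrite /q /qt; lra. Qed.

Lemma sqn_ge0 z : 0 <= sqn z.
Proof. by apply: sumr_ge0 => j _; exact: sqr_ge0. Qed.

(** [w z > 0] means that [logw] is positive, while it is at most Lam - |x|^2 / (2 q); this confines
    x. Since kap fid w <= w, the logarithm is at most ln (1 + w) = logw. *)
Lemma ansatz_support z : z.2 <= T -> 0 < w z ->
  [/\ sqn z <= 2 * q z * Lam & 0 <= ln (1 + d ^+ 3 * fid (w z)) <= Lam].
Proof.
move=> zT w0; have dq := qt_ge zT; have d20 : 0 < d ^+ 2 by rewrite exprn_gt0.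
have q0 : 0 < q z by exact: lt_le_trans dq.
have logw0 : 0 < logw T (d ^+ 2) L z by move: w0; rewrite /w /ww subr_gt0 expR_gt1.
have logq : n%:R / 2 * ln (q z) >= n%:R * ln d.
  have : ln (d ^+ 2) <= ln (q z) by rewrite ler_ln ?posrE.
  rewrite lnXn// => H; have := @ler_wpM2l R (n%:R / 2) _ _ _ H.
  rewrite divr_ge0// => /(_ isT); rewrite -mulr_natl; lra.
have logwE : logw T (d ^+ 2) L z <= Lam - sqn z / (2 * q z).
  rewrite /logw -/(q z) /L /Lam -addn3 natrD; move: logq; lra.
split.
  have : sqn z / (2 * q z) <= Lam by lra.
  by rewrite ler_pdivrMr ?mulr_gt0// mulrC.
have f0 : flat 0 (w z) <= 1.
  by have := flat_le 0 0 (ltW w0); rewrite expr0 mulr1.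
have H1 : d ^+ 3 * fid (w z) <= w z.
  rewrite /fid mulrCA -[leRHS]mulr1 ler_pM2l// -[leRHS]mulr1.
  by apply: ler_pM => //; exact: flat_ge0.
have H0 : 0 <= d ^+ 3 * fid (w z) by rewrite mulr_ge0// fid_ge0.
rewrite ln_ge0 ?lerDl//=.
apply: (@le_trans _ _ (logw T (d ^+ 2) L z)).
  rewrite -[leRHS]expRK ler_ln ?posrE ?expR_gt0//; last by rewrite ltr_pwDl.
  by rewrite -lerBrDl.
apply: le_trans logwE _; rewrite gerBl divr_ge0 ?sqn_ge0// mulr_ge0//.
exact: ltW.
Qed.

Lemma flat_le0 k (y : R) : y <= 0 -> flat k y = 0.
Proof. by rewrite /flat ltNge => ->. Qed.

Lemma udom_slab z : z.2 <= T -> udom T (d ^+ 2) z.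
Proof. by move=> /qt_ge; apply: lt_le_trans; rewrite exprn_gt0. Qed.

Lemma ansatz_eq0 z : w z <= 0 -> u z = 0.
Proof. by move=> w0; rewrite /u /ansatz /fid flat_le0// !mulr0 addr0 ln1 mulr0 oppr0. Qed.

Lemma residual_eq0 z : z.2 <= T -> w z <= 0 -> res z = 0.
Proof.
move=> zT w0; rewrite /res /u HJB_ansatz//; last exact: udom_slab.
rewrite -/(w z) /slope /fid' /fid !flat_le0//.
by rewrite !addr0 !mulr0 !mul0r expr0n/= mulr0 addr0 ln1 subr0 !mulr0 addr0.
Qed.

Lemma dec_bounds z : z.2 <= T -> 0 < dec z <= 1.
Proof.
move=> zT; rewrite /dec /decay expR_gt0 expR_le1 oppr_le0 divr_ge0 ?subr_ge0//.
Qed.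

(** The three terms come from the switch in time, from the uncancelled squared gradient with slope^2
    <= 9, and from the cutoff with [flat3_bounds]. On the support |x|^2 / q^2 is at most 2 Lam / q,
    hence at most 2 Lam / d^2. *)
Lemma residual_le z : z.2 <= T ->
  `|res z| <= Lam * (dec z / d ^+ 3 + 9 * dec z / d ^+ 2 + 11 * d ^+ 3 / d ^+ 2).
Proof.
move=> zT; have /andP[dec0 dec1] := dec_bounds zT.
have L1 := Lam_ge1; have L0 : 0 <= Lam by lra.
have d20 : 0 < d ^+ 2 by rewrite exprn_gt0.
have d30 : 0 < d ^+ 3 by rewrite exprn_gt0.
have rhs0 : 0 <= dec z / d ^+ 3 + 9 * dec z / d ^+ 2 + 11 * d ^+ 3 / d ^+ 2.
  by rewrite !addr_ge0 ?divr_ge0 ?mulr_ge0 ?ltW.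
have [w0|w0] := leP (w z) 0; first by rewrite residual_eq0// normr0 mulr_ge0.
have [S /andP[P0 P1]] := ansatz_support zT w0.
rewrite /res /u HJB_ansatz//; last exact: udom_slab.
rewrite -/(w z) -/(dec z) -/(q z).
have dq := qt_ge zT; have q0 : 0 < q z by exact: lt_le_trans dq.
have Q0 : 0 <= sqn z / q z ^+ 2 by rewrite divr_ge0 ?sqn_ge0// exprn_ge0 ?ltW.
have Q1 : sqn z / q z ^+ 2 <= 2 * Lam / d ^+ 2.
  rewrite ler_pdivrMr ?exprn_gt0//; apply: le_trans S _.
  rewrite -subr_ge0 (_ : _ - _ = 2 * Lam * q z / d ^+ 2 * (q z - d ^+ 2)).
    by rewrite mulr_ge0 ?subr_ge0// divr_ge0 ?(ltW d20)// !mulr_ge0// ltW.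
  by field; rewrite gt_eqF.
have := slope_bounds kap0 (w z) kap1; set G := slope _ _ => /andP[G0 G3].
have := flat3_bounds (w z); set F := _ ^+ 2 * _ => /andP[F0 F11].
have D1 : 1 <= 1 + d ^+ 3 * fid (w z) by rewrite lerDl mulr_ge0// fid_ge0.
set D := 1 + _ in P0 P1 D1 *; set Phi := ln D in P0 P1 *.
set Q := sqn z / _ in Q0 Q1 *.
have D0 : 0 < D by exact: lt_le_trans D1.
clearbody Phi Q F G D.
have FD0 : 0 <= d ^+ 3 * F / D := divr_ge0 (mulr_ge0 kap0 F0) (ltW D0).
have FD1 : d ^+ 3 * F / D <= 11 * d ^+ 3.
  rewrite ler_pdivrMr//.
  rewrite mulrC; apply: (@le_trans _ _ (11 * d ^+ 3 * 1)).
    by rewrite mulr1 ler_wpM2r.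
  by rewrite ler_wpM2l// mulr_ge0.
have GG : 0 <= dec z * G ^+ 2 <= 9 * dec z.
  rewrite mulr_ge0 ?sqr_ge0 ?(ltW dec0)//= mulrC ler_wpM2r ?(ltW dec0)//.
  by rewrite (_ : 9 = 3 ^+ 2) ?lerXn2r ?nnegrE//; rewrite expr2; lra.
apply: le_trans (ler_normD _ _) _.
have A1 : `|dec z / d ^+ 3 * Phi| <= Lam * (dec z / d ^+ 3).
  rewrite ger0_norm; last by rewrite mulr_ge0// divr_ge0// ltW.
  by rewrite mulrC ler_wpM2r// divr_ge0// ltW.
have A2 : `|(1 - dec z) / 2 * Q * (dec z * G ^+ 2 - d ^+ 3 * F / D)| <=
    Lam / d ^+ 2 * (9 * dec z + 11 * d ^+ 3).
  rewrite normrM; apply: ler_pM => //.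
    rewrite ger0_norm; last by rewrite mulr_ge0// divr_ge0//; lra.
    have -> : Lam / d ^+ 2 = 2^-1 * (2 * Lam / d ^+ 2) by field; rewrite gt_eqF.
    by apply: ler_pM => //; lra.
  move/andP: GG => [GG0 GG1].
  rewrite ler_norml; apply/andP; split; lra.
apply: le_trans (lerD A1 A2) _.
rewrite le_eqVlt; apply/orP; left; apply/eqP; field; by rewrite gt_eqF.
Qed.

Lemma ansatz_support_coord z (l : R) : z.2 <= T -> 0 <= l -> 2 * q z * Lam <= l ^+ 2 ->
  0 < w z -> forall i, - l <= z.1 0 i <= l.
Proof.
move=> zT l0 ql w0 i; have [S _] := ansatz_support zT w0.
have xi : (z.1 0 i) ^+ 2 <= l ^+ 2.
  apply: le_trans ql; apply: le_trans S; rewrite /sqn (bigD1 i)//= lerDl.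
  by apply: sumr_ge0 => j _; exact: sqr_ge0.
by rewrite -ler_norml -(ger0_norm l0) -ler_sqr ?nnegrE// !real_normK ?num_real.
Qed.

Lemma intRn_res_le (p c l t : R) : 0 < p -> 0 <= l -> t <= T ->
  2 * (T + d ^+ 2 - t) * Lam <= l ^+ 2 ->
  (forall x, `|res (x, t)| <= c) ->
  (intRn (fun x => (powR `|res (x, t)| p)%:E) <= (powR c p * (l *+ 2) ^+ n)%:E)%E.
Proof.
move=> p0 l0 tT ql resc.
apply: intRn_le_cube => // [|x|x xl]; first exact: powR_ge0.
- by rewrite lee_fin ge0_ler_powR ?nnegrE ?(ltW p0)// (le_trans _ (resc x)).
have [w0|w0] := leP (w (x, t)) 0; first by rewrite residual_eq0// normr0 powR0 ?gt_eqF.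
by case: xl; exact: (ansatz_support_coord (z := (x, t))).
Qed.

Lemma exp_inv_le : expR (- d^-1) <= 24 * d ^+ 4.
Proof.
have := flat_le 0 4 (ltW d0); rewrite /flat d0 expr0 invr1 mul1r => /le_trans; apply.
by rewrite ler_wpM2r ?exprn_ge0 ?(ltW d0)// !factS fact0.
Qed.

(** Here (T - t) / d^3 >= 1 / d, and exp (- 1 / d) is at most 4! d^4. *)
Lemma dec_late z : z.2 <= T - d ^+ 2 -> dec z <= 24 * d ^+ 4.
Proof.
move=> zT; apply: le_trans exp_inv_le; rewrite /dec /decay ler_expR lerN2.
rewrite ler_pdivlMr ?exprn_gt0// (_ : d^-1 * d ^+ 3 = d ^+ 2); first lra.
by field; rewrite gt_eqF.
Qed.

(** Two regimes meet at t = T - d^2. Before it the switch is complete up to O(d^4), so the residual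
    is O(Lam d) on a cube of side O((T + 1) Lam). After it the residual is only O(Lam / d^3), but q
    <= 2 d^2 confines the support to a cube of side O(d Lam). *)
Lemma intRn_res_small (p eta t : R) : 1 <= p -> 0 <= t <= T ->
  powR (21 * Lam / d ^+ 3) p * (4 * (d * Lam)) ^+ n <= eta ->
  powR (251 * Lam * d) p * (4 * ((T + 1) * Lam)) ^+ n <= eta ->
  (intRn (fun x => (powR `|res (x, t)| p)%:E) <= eta%:E)%E.
Proof.
move=> p1 /andP[t0 tT] H1 H2; have p0 : 0 < p by exact: lt_le_trans p1.
have L1 := Lam_ge1; have L0 : 0 <= Lam by apply: le_trans L1.
have dn0 : d != 0 by rewrite gt_eqF.
have d20 : 0 < d ^+ 2 by rewrite exprn_gt0.
have d21 : d ^+ 2 <= 1 by rewrite exprn_ile1// ltW.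
have LL : Lam <= Lam ^+ 2 by rewrite expr2 -[leLHS]mulr1 ler_wpM2l.
have T1 : 0 <= T + 1 by apply: addr_ge0 => //; exact: ltW.
have d30 : 0 < d ^+ 3 by rewrite exprn_gt0.
have di : 1 <= (d ^+ 3)^-1 by rewrite invf_ge1.
have d32 : d ^+ 3 / d ^+ 2 = d by field.
have [tl|te] := leP t (T - d ^+ 2).
  apply: (@le_trans _ _ (powR (251 * Lam * d) p * ((2 * ((T + 1) * Lam)) *+ 2) ^+ n)%:E).
    apply: intRn_res_le => //; first by rewrite mulr_ge0// mulr_ge0.
      apply: (@le_trans _ _ (2 * (T + 1) * Lam)).
        by rewrite ler_wpM2r// ler_wpM2l//; lra.
      rewrite (_ : (2 * _) ^+ 2 = 2 * (T + 1) * Lam * (2 * (T + 1) * Lam)); last by ring.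
      rewrite ler_peMr ?mulr_ge0//.
      by rewrite -[1]mulr1; apply: ler_pM => //; lra.
    move=> x; apply: le_trans (residual_le _) _ => //.
    have := @dec_late (x, t) tl; move: (dec _) => a ad.
    have a3 : a / d ^+ 3 <= 24 * d.
      by rewrite ler_pdivrMr// -mulrA -exprS.
    have a2 : a / d ^+ 2 <= 24 * d.
      rewrite ler_pdivrMr// -mulrA -exprS; apply: le_trans ad _.
      by rewrite ler_wpM2l// exprS ler_piMl ?(ltW d30).
    (* 251 = 24 + 9 * 24 + 11, from the three terms of [residual_le]. *)
    rewrite (_ : 251 * Lam * d = Lam * (251 * d)); last by ring.
    rewrite ler_wpM2l//; move: a3 a2 d32; rewrite -!(mulrA _ _ (d ^+ 2)^-1); lra.
  rewrite lee_fin; apply: le_trans H2.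
  by rewrite (_ : 4 * _ = 2 * ((T + 1) * Lam) *+ 2)//; ring.
apply: (@le_trans _ _ (powR (21 * Lam / d ^+ 3) p * ((2 * (d * Lam)) *+ 2) ^+ n)%:E).
  apply: intRn_res_le => //; first by rewrite mulr_ge0// mulr_ge0 ?(ltW d0).
    apply: (@le_trans _ _ (2 * (2 * d ^+ 2) * Lam ^+ 2)).
      apply: ler_pM => //; first by rewrite mulr_ge0//; lra.
      by rewrite ler_wpM2l//; lra.
    by rewrite le_eqVlt; apply/orP; left; apply/eqP; ring.
  move=> x; apply: le_trans (residual_le _) _ => //.
  have /andP[] := @dec_bounds (x, t) tT; move: (dec _) => a a0 a1.
  have a3 : a / d ^+ 3 <= (d ^+ 3)^-1 by rewrite ler_piMl// invr_ge0 ltW.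
  have a2 : a / d ^+ 2 <= (d ^+ 3)^-1.
    rewrite ler_pdivrMr// mulrC ler_pdivlMr//.
    rewrite -[leRHS]mul1r; apply: ler_pM => //; first exact: ltW.
    by rewrite exprS ler_piMl ?(ltW d20).
  (* 21 = 1 + 9 + 11, each term of [residual_le] being compared with d^-3. *)
  rewrite (_ : 21 * Lam / d ^+ 3 = Lam * (21 * (d ^+ 3)^-1)); last by ring.
  rewrite ler_wpM2l//; move: a3 a2 d32; rewrite -!(mulrA _ _ (d ^+ 2)^-1) => A B ->.
  move: A B (le_trans d1 di); move: (a / d ^+ 3) (a / d ^+ 2) (d ^- 3) => ? ? ?; lra.
rewrite lee_fin; apply: le_trans H1.
by rewrite (_ : 4 * _ = 2 * (d * Lam) *+ 2)//; ring.
Qed.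

Lemma ansatz_terminal x : u (x, T) = 0.
Proof. by rewrite /u /ansatz /decay /= subrr mul0r oppr0 expR0 subrr mul0r oppr0. Qed.

Lemma ansatz_compact_support : compact (closure [set z | slab_oc T z /\ u z != 0]).
Proof.
have L1 := Lam_ge1; have L0 : 0 <= Lam by apply: le_trans L1.
(* A half-width valid at all times: 2 q Lam <= l <= l^2, as q <= T + 1 and l >= 1. *)
pose l := 2 * ((T + 1) * Lam) .
pose K : set (pt R n) := [set x : 'rV[R]_n | forall i, `[- l, l] (x 0 i)] `*` `[0, T].
have cK : compact K.
  apply: compact_setX; last exact: segment_compact.
  by apply: (@rV_compact _ n (fun=> `[- l, l])) => i; exact: segment_compact.
apply: (subclosed_compact _ cK); first exact: closed_closure.
have /closure_id -> : closed K by apply: compact_closed cK; exact: norm_hausdorff.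
apply: closure_subset => y [/andP[y0 yT] uy].
have w0 : 0 < w y by rewrite ltNge; apply: contra uy => /ansatz_eq0 ->.
split; last by rewrite /= in_itv/= yT ltW.
move=> i; rewrite /= in_itv/=; apply: ansatz_support_coord => //.
  by rewrite mulr_ge0// mulr_ge0// addr_ge0// ltW.
have d21 : d ^+ 2 <= 1 by rewrite exprn_ile1// ltW.
have T1 : 1 <= T + 1 by move: T0; lra.
have T10 : 0 <= T + 1 by apply: le_trans T1.
have q1 : q y <= T + 1 by rewrite /q /qt; lra.
apply: (@le_trans _ _ (2 * (T + 1) * Lam)).
  by rewrite ler_wpM2r// ler_wpM2l.
rewrite (_ : (2 * _) ^+ 2 = 2 * (T + 1) * Lam * (2 * (T + 1) * Lam)); last by ring.
rewrite ler_peMr ?mulr_ge0//.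
by rewrite -[1]mulr1; apply: ler_pM => //; lra.
Qed.

(** On this region the terms subtracted from [L] in [logw] are at most n T / 2 and n / T, so this
    [lam] leaves w + 1 >= exp M / d^3. The powers of d cancel in d^3 fid w, hence a bound
    independent of d. *)
Lemma ansatz_ge (M : R) (x : 'rV[R]_n) (t : R) : d <= T / 2 -> 1 <= M ->
  lam = n%:R * T / 2 + n%:R / T + M ->
  (forall i, 0 <= x 0 i <= 1) -> 0 <= t <= T / 2 -> (M - 2) / 2 <= `|u (x, t)|.
Proof.
move=> dT M1 lamE x01 /andP[t0 tT].
have zT : t <= T by lra.
have d20 : 0 < d ^+ 2 by rewrite exprn_gt0.
have d30 : 0 < d ^+ 3 by rewrite exprn_gt0.
have d21 : d ^+ 2 <= 1 by rewrite exprn_ile1// ltW.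
have d3d : d ^+ 3 <= d.
  by rewrite exprS -[leRHS]mulr1 ler_wpM2l ?exprn_ile1// ltW.
set z : pt R n := (x, t).
have sqn1 : sqn z <= n%:R.
  rewrite -[n in leRHS]card_ord -sum1_card natr_sum; apply: ler_sum => i _ /=.
  by have /andP[x0 x1] := x01 i; rewrite exprn_ile1.
have q1 : q z <= 1 + T by rewrite /q /qt /=; lra.
have q2 : T / 2 <= q z by rewrite /q /qt /=; lra.
have q0 : 0 < q z by apply: lt_le_trans q2; rewrite divr_gt0.
have lnq : ln (q z) <= T.
  apply: le_trans (@le_ln1Dx _ T _); last by lra.
  by rewrite ler_ln ?posrE//; lra.
have sq : sqn z / (2 * q z) <= n%:R / T.
  rewrite ler_pdivrMr ?mulr_gt0// mulrAC ler_pdivlMr//.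
  apply: ler_pM => //; [exact: sqn_ge0|exact: ltW|lra].
have lE : M - 3 * ln d <= logw T (d ^+ 2) L z.
  rewrite /logw -/(q z) /L lamE.
  have : n%:R / 2 * ln (q z) <= n%:R * T / 2.
    by rewrite mulrAC ler_wpM2r// ler_wpM2l.
  by move: sq; lra.
have wE : expR M / d ^+ 3 <= w z + 1.
  rewrite /w /ww subrK; apply: le_trans (_ : expR (M - 3 * ln d) <= _).
    by rewrite expRB [3 * _]mulrC expRM_natr lnK ?posrE.
  by rewrite ler_expR.
have e2 : 2 <= expR (1 : R) by have := expR_ge1Dx (1 : R); lra.
have eM : 2 <= expR M by apply: le_trans e2 _; rewrite ler_expR.
have eMd : 2 <= expR M / d ^+ 3.
  by rewrite ler_pdivlMr//; apply: le_trans eM; rewrite -[leRHS]mulr1 ler_wpM2l.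
have w1 : 1 <= w z by lra.
(* As [w z >= 1], both w >= (w + 1) / 2 and exp (- 1 / w) >= exp (- 1). *)
have fidE : (w z + 1) / 2 * expR (-1) <= fid (w z).
  have w0 : 0 < w z by lra.
  rewrite /fid /flat w0 expr0 invr1 mul1r; apply: ler_pM => //.
  - by rewrite divr_ge0//; lra.
  - by lra.
  - by rewrite ler_expR lerN2 invf_le1.
(* One factor exp (- 1) comes from [fidE]; the other is at most the 1 / 2 found there. *)
have kf : expR (M - 2) <= d ^+ 3 * fid (w z).
  apply: le_trans (_ : d ^+ 3 * ((w z + 1) / 2 * expR (-1)) <= _); last first.
    by rewrite ler_wpM2l.
  have -> : expR (M - 2) = expR M * expR (-1) * expR (-1).
    by rewrite -!expRD; congr expR; ring.
  rewrite mulrA ler_wpM2r ?expR_ge0//.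
  apply: le_trans (_ : d ^+ 3 * (expR M / d ^+ 3 / 2) <= _); last first.
    by rewrite ler_wpM2l// ler_wpM2r.
  rewrite (_ : d ^+ 3 * _ = expR M * 2^-1); last by field; rewrite gt_eqF.
  by rewrite ler_wpM2l ?expR_ge0// expRN lef_pV2// ?posrE ?expR_gt0.
have lnE : M - 2 <= ln (1 + d ^+ 3 * fid (w z)).
  rewrite -[leLHS]expRK ler_ln ?posrE ?expR_gt0//.
    by apply: le_trans kf _; rewrite lerDr.
  by rewrite ltr_pwDl// mulr_ge0 ?fid_ge0.
have ln0 : 0 <= ln (1 + d ^+ 3 * fid (w z)).
  by rewrite ln_ge0// lerDl mulr_ge0 ?fid_ge0.
(* T - t >= T / 2 >= d >= d^3, so the exponent in [dec] is at most - 1. *)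
have decE : dec z <= 2^-1.
  apply: le_trans (_ : expR (-1) <= _).
    rewrite /dec /decay ler_expR lerN2 ler_pdivlMr// mul1r /=; lra.
  by rewrite expRN lef_pV2// posrE// expR_gt0.
rewrite /u /ansatz -/(w z) -/(dec z) normrN ger0_norm; last first.
  by rewrite mulr_ge0//; lra.
apply: le_trans (_ : ln (1 + d ^+ 3 * fid (w z)) / 2 <= _).
  by rewrite ler_wpM2r.
by rewrite mulrC ler_wpM2r//; lra.
Qed.

End estimates.

(** * Choice of the scale d against the logarithmic factors *)

Lemma scale_choice (R : realType) (n : nat) (T lam eta d0 p : R) :
  (1 <= n)%N -> 0 < T -> 1 <= lam -> 0 < eta -> 0 < d0 -> 1 <= p <= n%:R / 4 ->
  exists d, [/\ 0 < d, d <= 1, d <= d0,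
    powR (21 * (lam - n.+3%:R * ln d) / d ^+ 3) p
      * (4 * (d * (lam - n.+3%:R * ln d))) ^+ n <= eta &
    powR (251 * (lam - n.+3%:R * ln d) * d) p
      * (4 * ((T + 1) * (lam - n.+3%:R * ln d))) ^+ n <= eta].
Proof.
move=> n1 T0 lam1 eta0 d00 /andP[p1 p2].
(* The scale is d = k^M, where 3 M + 1 = 4 (3 n + 7) is divisible by 4 for the sake of [Y] below. *)
pose M := (4 * n + 9)%N.
(* Since - ln k <= 1 / k, the logarithm costs a single power of k: Lam <= C / k. *)
pose C := lam + n.+3%:R * M%:R : R.
have C1 : 1 <= C by rewrite -[1]addr0 lerD.
have C0 : 0 <= C by apply: le_trans C1.
pose B2 := 251 * C * (4 * ((T + 1) * C)) ^+ n.
have T1 : 0 <= T + 1 by rewrite addr_ge0// ltW.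
have B20 : 0 <= B2 by rewrite !mulr_ge0// exprn_ge0// !mulr_ge0.
pose B := 84 * C ^+ 2 + 251 * C + B2.
have C20 : 0 <= C ^+ 2 by exact: exprn_ge0.
have B1 : 1 <= B.
  apply: (@le_trans _ _ (251 * C)); first lra.
  by rewrite /B -addrA addrCA lerDl addr_ge0// mulr_ge0.
have B0 : 0 < B by apply: lt_le_trans B1.
(* With [k] = 1 / (B K), the common final bound B k = 1 / K is at most 1, [eta] and [d0] at once. *)
pose K := 1 + eta^-1 + d0^-1.
have ei : 0 < eta^-1 by rewrite invr_gt0.
have di : 0 < d0^-1 by rewrite invr_gt0.
have K1 : 1 <= K by rewrite /K; lra.
have K0 : 0 < K by apply: lt_le_trans K1.
pose k := (B * K)^-1.
have k0 : 0 < k by rewrite invr_gt0 mulr_gt0.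
have Bk : B * k = K^-1 by rewrite /k; field; rewrite !gt_eqF.
have Bk1 : B * k <= 1 by rewrite Bk invf_le1.
have Bke : B * k <= eta.
  by rewrite Bk -[leRHS]invrK lef_pV2 ?posrE// /K; lra.
have Bkd : B * k <= d0.
  by rewrite Bk -[leRHS]invrK lef_pV2 ?posrE// /K; lra.
have kB : k <= B * k by rewrite ler_peMl// ltW.
have k1 : k <= 1 by apply: le_trans Bk1.
have kn0 : k != 0 by rewrite gt_eqF.
have [d dE] : exists d, d = k ^+ M by eexists.
exists d.
have d_gt0 : 0 < d by rewrite dE exprn_gt0.
have dk : d <= k by rewrite dE /M addnS exprS ler_piMr ?exprn_ile1 ?(ltW k0).
set Lam := lam - _.
have LamC : Lam <= C / k.
  have : - ln k <= k^-1.
    by rewrite -lnV ?posrE// ltW// ln_sublinear// invr_gt0.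
  have : 1 <= k^-1 by rewrite invf_ge1.
  rewrite /Lam dE lnXn// -(mulr_natl (ln k)) /C.
  rewrite mulrA; have : 0 <= n.+3%:R * M%:R :> R by rewrite mulr_ge0.
  move: (n.+3%:R * M%:R) (ln k) k^-1 => N x y N0 y1 xy.
  have A1 : lam <= lam * y by rewrite ler_peMr//; lra.
  have := ler_wpM2l N0 xy; lra.
have Lam1 : 1 <= Lam.
  have : n.+3%:R * ln d <= 0.
    by rewrite mulr_ge0_le0// ln_le0// (le_trans dk).
  by rewrite /Lam; move: (_ * ln d) => x; lra.
have Lam0 : 0 <= Lam by apply: le_trans Lam1.
split=> //; [exact: le_trans k1|by apply: le_trans Bkd; apply: le_trans kB| |].
(* Y^4 dominates 21 Lam / d^3, so p <= n / 4 bounds the power by Y^n, which has the exponent of the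
   volume factor. In the product of the bases, k^(4n + 8) against k^-(3n + 7) leaves k^(n + 1). *)
- pose Y := 21 * C / k ^+ (3 * n + 7).
  have C21 : 1 <= 21 * C by lra.
  have Y1 : 1 <= Y.
    by rewrite /Y mulr_ege1// invf_ge1 ?exprn_ile1 ?exprn_gt0 ?(ltW k0).
  have Y0 : 0 <= Y by apply: le_trans Y1.
  have XY : 21 * Lam / d ^+ 3 <= Y ^+ 4.
    apply: (@le_trans _ _ (21 * (C / k) / d ^+ 3)).
      by rewrite ler_wpM2r ?invr_ge0 ?exprn_ge0 ?(ltW d_gt0)// ler_wpM2l.
    rewrite mulrA -mulrA -invfM dE -exprM -exprS /Y expr_div_n -exprM.
    have -> : (M * 3).+1 = ((3 * n + 7) * 4)%N by rewrite /M; clear; lia.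
    by rewrite ler_wpM2r ?invr_ge0 ?exprn_ge0 ?(ltW k0)// ler_eXnr.
  have X0 : 0 <= 21 * Lam / d ^+ 3.
    by apply: divr_ge0; [exact: mulr_ge0|apply: exprn_ge0; exact: ltW].
  have H1 : powR (21 * Lam / d ^+ 3) p <= Y ^+ n.
    apply: (@le_trans _ _ (powR (Y ^+ 4) p)).
      by rewrite ge0_ler_powR ?nnegrE ?exprn_ge0// (le_trans _ p1).
    apply: (@le_trans _ _ (powR (Y ^+ 4) (n%:R / 4))).
      by apply: ler_powR p2; rewrite exprn_ege1.
    rewrite -powR_mulrn// -powRrM -(@powR_mulrn _ Y n)//.
    by rewrite mulrC divfK.
  have H2 : 4 * (d * Lam) <= 4 * C * k ^+ (4 * n + 8).
    rewrite -mulrA ler_wpM2l//.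
    apply: (@le_trans _ _ (d * (C / k))); first by rewrite ler_wpM2l// ltW.
    by rewrite dE /M addnS exprS le_eqVlt; apply/orP; left; apply/eqP; field.
  apply: (@le_trans _ _ (Y ^+ n * (4 * C * k ^+ (4 * n + 8)) ^+ n)).
    apply: ler_pM; rewrite ?powR_ge0 ?exprn_ge0 ?mulr_ge0 ?(ltW d_gt0)//.
    by rewrite lerXn2r ?nnegrE ?mulr_ge0 ?exprn_ge0 ?(ltW d_gt0) ?(ltW k0).
  rewrite -exprMn (_ : Y * _ = 84 * C ^+ 2 * k ^+ n * k); last first.
    rewrite /Y (_ : 4 * n + 8 = 3 * n + 7 + n.+1)%N; last by clear; lia.
    move: (3 * n + 7)%N => m; rewrite exprD (exprSr k n); move: (k ^+ n) => x; field.
    by rewrite expf_neq0.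
  have XB : 84 * C ^+ 2 * k ^+ n * k <= B * k.
    rewrite ler_wpM2r ?(ltW k0)//; apply: (@le_trans _ _ (84 * C ^+ 2)).
      by rewrite ler_piMr ?mulr_ge0// exprn_ile1// ltW.
    by rewrite /B -addrA lerDl addr_ge0// mulr_ge0.
  apply: le_trans (le_trans XB Bke).
  rewrite ler_iXnr//; last exact: le_trans XB Bk1.
  by rewrite !mulr_ge0 ?exprn_ge0 ?(ltW k0).
- have X0 : 0 < 251 * Lam * d by rewrite !mulr_gt0// (lt_le_trans _ Lam1).
  (* k^(n + 1) is kept because the volume factor costs k^-n; one power of k survives. *)
  have XC : 251 * Lam * d <= 251 * C * k ^+ n * k.
    apply: (@le_trans _ _ (251 * C * k ^+ (4 * n + 8))).
      apply: (@le_trans _ _ (251 * (C / k) * d)).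
        by rewrite ler_wpM2r ?(ltW d_gt0)// ler_wpM2l.
      by rewrite dE /M addnS exprS le_eqVlt; apply/orP; left; apply/eqP; field.
    rewrite -[leRHS]mulrA -exprSr ler_wpM2l ?mulr_ge0// ler_wiXn2l ?(ltW k0)//; clear; lia.
  have XB : 251 * C * k ^+ n * k <= B * k.
    rewrite ler_wpM2r ?(ltW k0)//; apply: (@le_trans _ _ (251 * C)).
      by rewrite ler_piMr ?mulr_ge0// exprn_ile1// ltW.
    by rewrite /B -addrA addrCA lerDl addr_ge0// mulr_ge0.
  have H1 : powR (251 * Lam * d) p <= 251 * C * k ^+ n * k.
    apply: (le_trans _ XC); apply: ge1r_powR => //.
    by rewrite X0 (le_trans XC)// (le_trans XB).
  have H2 : (4 * ((T + 1) * Lam)) ^+ n <= (4 * ((T + 1) * C)) ^+ n / k ^+ n.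
    have Z0 : 0 <= 4 * ((T + 1) * Lam) by rewrite mulr_ge0// mulr_ge0.
    have ZC : 4 * ((T + 1) * Lam) <= 4 * ((T + 1) * C) / k.
      by rewrite -2!mulrA ler_wpM2l// ler_wpM2l.
    by rewrite -expr_div_n lerXn2r// nnegrE (le_trans Z0).
  apply: (@le_trans _ _ (251 * C * k ^+ n * k * ((4 * ((T + 1) * C)) ^+ n / k ^+ n))).
    by apply: ler_pM; rewrite ?powR_ge0 ?exprn_ge0 ?mulr_ge0.
  rewrite (_ : _ * _ = B2 * k); last first.
    have kn : k ^+ n != 0 by rewrite expf_neq0.
    by rewrite /B2; move: (k ^+ n) kn => x x0; field.
  by apply: le_trans Bke; rewrite ler_wpM2r ?(ltW k0)// /B lerDr addr_ge0// mulr_ge0.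
Qed.

(** * The instance with zero solution and its perturbation by the ansatz *)

Unset Implicit Arguments.

Theorem theorem4p4 (R : realType) (n : nat) (T : R) :
  (1 <= n)%N -> 0 < T ->
  exists (sigma : R) (A c : 'I_n -> R) (phi : pt R n -> R)
         (g : 'rV[R]_n -> R) (ustar : pt R n -> R),
    [/\ 0 < sigma, (forall i, 0 < A i), (forall i, 1 < c i) &
        [/\ smooth_on (@slab_cc R n T) ustar,
        (forall z : pt R n, 0 < z.2 < T -> HJB sigma A c ustar z = phi z) &
        (forall x, ustar (x, T) = g x)]] /\
    forall (eps Abig r : R) (m : nat) (p : R),
      0 < eps -> 0 < Abig -> 1 <= r -> 1 <= p <= n%:R / 4 ->
      exists u : pt R n -> R,
        [/\ smooth_on (@slab_oc R n T) u,
            (LpSlab p T (fun z => (HJB sigma A c u z - phi z)%R) < eps%:E)%E,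
            (forall x, u (x, T) = ustar (x, T)),
            compact (closure [set z | @slab_oc R n T z /\ u z != ustar z]) &
            (Abig%:E < WmrSlab m r T (fun z => (u z - ustar z)%R))%E].
Proof.
move=> n1 T0; exists 1, (fun=> 2^-1), (fun=> 2), (fun=> 0), (fun=> 0), (fun=> 0).
split.
  split=> //; [by move=> i; rewrite ltr1n|split=> //].
    exists setT; split=> //; first exact: openT.
    by exists (fun=> 0); split=> //; apply: sm_smooth_open; [exact: openT|exact: sm_cst].
  move=> z _; have pd0 (v w : pt R n) : 'D_v (fun=> (0 : R)) w = 0.
    exact: (derive_cst (0 : R)).
  have pdx0 i : pdx i (fun _ : pt R n => (0 : R)) = (fun=> 0).
    by apply/funext => w; exact: pd0.
  rewrite /HJB /laplacian /pdt pd0 !big1 ?mulr0 ?addr0 ?subr0// => i _.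
    by rewrite pdx0 normr0 powR0 ?mulr0// pnatr_eq0.
  by rewrite !pdx0.
move=> eps Abig r m p eps0 A0 r1 p1n; have /andP[p1 _] := p1n.
(* As r >= 1, (T / 2) (1 + 2 / T)^r is at least T / 2 + 1 > 1, so (T / 2) M^r exceeds Abig^r. *)
pose M := Abig * (1 + 2 / T).
have T2 : 0 < 2 / T by rewrite divr_gt0.
have M0 : 0 < M by rewrite mulr_gt0// addr_gt0.
(* The summand 2 M + 2 makes the lower bound of [ansatz_ge] equal to M. *)
pose lam := n%:R * T / 2 + n%:R / T + (2 * M + 2).
have lam1 : 1 <= lam.
  have : 0 <= n%:R * T / 2 by rewrite divr_ge0// mulr_ge0// ltW.
  have : 0 <= n%:R / T by rewrite divr_ge0// ltW.
  by rewrite /lam; lra.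
(* Integrated over [0, T] this gives half of eps^p, hence a strict inequality. *)
pose eta := powR eps p / (2 * T).
have eps_p0 : 0 < powR eps p by rewrite powR_gt0.
have eta0 : 0 < eta by rewrite divr_gt0// mulr_gt0.
have Td0 : 0 < T / 2 by rewrite divr_gt0.
have [d [d0 d1 dT H1 H2]] := scale_choice n1 T0 lam1 eta0 Td0 p1n.
pose u : pt R n -> R := ansatz T (d ^+ 2) (d ^+ 3) (d ^+ 3) (lam - 3 * ln d).
have e0 : 0 < d ^+ 2 by rewrite exprn_gt0.
have k0 : 0 <= d ^+ 3 by rewrite exprn_ge0// ltW.
exists u; split.
- exists (udom T (d ^+ 2)); split; first exact: open_udom.
    by move=> z /andP[_ zT]; exact: udom_slab.
  exists u; split=> //; apply: sm_smooth_open; first exact: open_udom.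
  exact: sm_ansatz.
- apply: (LpSlab_lt (eta := eta)) => //; first exact: ltW.
    rewrite (_ : T * eta = powR eps p / 2); last first.
      by rewrite /eta; field; rewrite gt_eqF.
    by move: (powR eps p) eps_p0 => x x0; lra.
  move=> t t0T; under [X in intRn X]funext do rewrite subr0.
  exact: intRn_res_small.
- by move=> x; exact: ansatz_terminal.
- exact: ansatz_compact_support.
- apply: (@WmrSlab_gt R n m r T M Abig) => //; first exact: ltW.
    rewrite powRM ?(ltW A0) ?addr_ge0 ?(ltW T2)// mulrCA -[ltLHS]mulr1.
    rewrite ltr_pM2l ?powR_gt0//.
    apply: (@lt_le_trans _ _ (T / 2 * (1 + 2 / T))).
      rewrite mulrDr mulr1 [X in _ + X](_ : _ = 1); first by lra.
      by field; rewrite gt_eqF.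
    rewrite ler_wpM2l ?(ltW Td0)// le1r_powR//; lra.
  move=> x t x01 t0T; rewrite subr0 (_ : M = (2 * M + 2 - 2) / 2); last by field.
  by apply: ansatz_ge => //; lra.
Qed.
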